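(* Let $\mathcal{M}$ be a paving matroid of rank $4$. Then all roots of $\mathrm{Rel}(\mathcal{M};q)$ lie in the closed unit disk $\{z\in\mathbb{C}:|z|\le 1\}$.
   Context: A matroid on a nonempty finite set $X$ is a nonempty collection $\mathcal{M}$ of subsets of $X$ closed under taking subsets and satisfying the exchange axiom: if $\sigma,\alpha\in\mathcal{M}$ with $|\sigma|<|\alpha|$, there is $z\in\alpha\setminus\sigma$ with $\sigma\cup\{z\}\in\mathcal{M}$. Its rank $r$ is the largest cardinality of a member of $\mathcal{M}$. A matroid of rank $r$ on $X$ is paving if every $(r-1)$-element subset of $X$ belongs to $\mathcal{M}$. The reliability polynomial is $\mathrm{Rel}(\mathcal{M};q)=\sum_{\sigma\in\mathcal{M}} q^{|\sigma|}(1-q)^{|X\setminus\sigma|}$. *)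

(* Defs.v *)
From HB Require Import structures.
From mathcomp Require Import all_boot all_order all_algebra.

Set Implicit Arguments.
Unset Strict Implicit.
Unset Printing Implicit Defensive.

Import GRing.Theory.
Local Open Scope ring_scope.

(* The ground set is the whole finite type X, and a matroid on X is given by
   its collection M of independent sets. *)
Definition matroid (X : finType) (M : {set {set X}}) : Prop :=
  [/\ (0 < #|X|)%N,
      M != set0,
      (forall s t : {set X}, t \in M -> s \subset t -> s \in M) &
      (forall s a : {set X}, s \in M -> a \in M -> (#|s| < #|a|)%N ->
        exists2 z : X, z \in a :\: s & z |: s \in M)].

Definition mrank (X : finType) (M : {set {set X}}) : nat :=
  (\max_(s in M) #|s|)%N.

(* "#|s| = mrank M - 1" is written without truncated subtraction, so that the
   condition is vacuous in rank 0. *)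
Definition paving (X : finType) (M : {set {set X}}) : Prop :=
  matroid M /\ forall s : {set X}, #|s|.+1 = mrank M -> s \in M.

Definition Rel (K : nzRingType) (X : finType) (M : {set {set X}}) : {poly K} :=
  \sum_(s in M) 'X ^+ #|s| * (1 - 'X) ^+ #|~: s|.

(* Main.v *)
(** Write [#|X| = n + 4]. Then [Rel M = (1 - q)^n * H], where
    [H = 1 + n q + h2 q^2 + h3 q^3 + h4 q^4], [h2 = 'C(n + 1, 2)],
    [h3 = 'C(n + 2, 3)] and [h4] is the number of bases minus ['C(n + 3, 3)].

    If some [X :\ e] contains no basis, then the bases are exactly the sets
    [e |: T] with [T] a 3-subset of [X :\ e], so [h4 = 0]. Otherwise the number
    of dependent 4-sets is at most ['C(n + 2, 4) + 1 + 'C(n, 2)], by induction on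
    the size of a subset [Y] of [X]: either some [Y :\ a :\ b] contains no basis,
    and then every other dependent 4-set contains [a] and [b], the remaining
    pairs being disjoint; or the induction hypothesis applies to all deletions
    [Y :\ e], and one averages over [e]. This gives [h4 >= h3 - h2 + n - 1],
    that is, [H (-1) >= 0].

    Under this inequality the Schur-Cohn recursion shows [|H z| > |H^* z|] for
    [|z| > 1], where [H^*] is the reciprocal polynomial, up to a few small cases
    that are checked by hand. *)

Require Import Defs.
From HB Require Import structures.
From mathcomp Require Import all_boot all_order all_algebra.
From mathcomp Require Import complex reals.
From mathcomp Require Import zify ring lra.

Set Implicit Arguments.
Unset Strict Implicit.
Unset Printing Implicit Defensive.

Import Order.TTheory GRing.Theory Num.Theory.

(** * Counting dependent 4-sets *)

Definition dependent4 (X : finType) (M : {set {set X}}) (Y : {set X}) :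
    {set {set X}} :=
  [set d : {set X} | [&& d \subset Y, #|d| == 4 & d \notin M]].

(* The bound for [k + 5] elements. *)
Definition dependent4_bound (k : nat) : nat := 'C(k.+3, 4) + 1 + 'C(k.+1, 2).

Lemma mul_bin4 k : 24 * 'C(k.+3, 4) = k.+3 * k.+2 * k.+1 * k.
Proof.
have := bin_ffact k.+3 4; rewrite !ffactnS ffactn0 !factS fact0 /=.
by move=> h; lia.
Qed.

Lemma mul_bin3 k : 6 * 'C(k.+2, 3) = k.+2 * k.+1 * k.
Proof.
have := bin_ffact k.+2 3; rewrite !ffactnS ffactn0 !factS fact0 /=.
by move=> h; lia.
Qed.

Lemma mul_bin2 k : 2 * 'C(k.+1, 2) = k.+1 * k.
Proof.
have := bin_ffact k.+1 2; rewrite !ffactnS ffactn0 !factS fact0 /=.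
by move=> h; lia.
Qed.

(** The arithmetic of averaging: a set of size [k + 6] has [k + 6] deletions, and each 4-subset
    survives [k + 2] of them. *)
Lemma dependent4_bound_step k :
  (k + 6) * dependent4_bound k <= (k + 2) * dependent4_bound k.+1.
Proof.
rewrite /dependent4_bound.
have := mul_bin4 k; have := mul_bin4 k.+1.
have := mul_bin2 k; have := mul_bin2 k.+1.
move: 'C(_, _) 'C(_, _) 'C(_, _) 'C(_, _) => a b c d; nia.
Qed.

(** Double counting: a 4-subset of [Y] survives exactly the deletions of elements outside it. *)
Lemma dependent4_deletion (X : finType) (M : {set {set X}}) (Y : {set X}) :
  \sum_(e in Y) #|dependent4 M (Y :\ e)| = (#|Y| - 4) * #|dependent4 M Y|.
Proof.
have -> : \sum_(e in Y) #|dependent4 M (Y :\ e)| =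
    \sum_(e in Y) \sum_(d in dependent4 M Y) (e \notin d : nat).
  apply: eq_bigr => e eY; rewrite -sum1_card big_mkcond /= [RHS]big_mkcond /=.
  apply: eq_bigr => d _; rewrite !inE subsetD1.
  by case: (d \subset Y); case: (e \in d); case: (#|d| == 4); case: (d \in M).
rewrite exchange_big /= mulnC -sum_nat_const; apply: eq_bigr => d.
rewrite inE => /and3P[dY /eqP d4 _].
rewrite -d4 -(cardsDS dY) -sum1_card big_mkcond /= [RHS]big_mkcond /=.
by apply: eq_bigr => e _; rewrite !inE; case: (e \in Y); case: (e \in d).
Qed.

Lemma card_trivIset_const (X : finType) (P : {set {set X}}) (Y : {set X}) k :
  trivIset P -> (forall p, p \in P -> p \subset Y /\ #|p| = k) ->
  k * #|P| <= #|Y|.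
Proof.
move=> /eqP tP hP; rewrite mulnC -sum_nat_const.
have -> : \sum_(p in P) k = \sum_(p in P) #|p|.
  by apply: eq_bigr => p /hP[].
rewrite tP; apply: subset_leq_card; apply/bigcupsP => p /hP[] //.
Qed.

Definition has_basis4 (X : finType) (M : {set {set X}}) (Y : {set X}) : bool :=
  [exists s in M, (s \subset Y) && (#|s| == 4)].

(** [T] ranges over all 3-sets because a paving matroid of rank 4 contains each of them. *)
Definition exchange4 (X : finType) (M : {set {set X}}) : Prop :=
  forall T s : {set X}, #|T| = 3 -> s \in M -> #|s| = 4 ->
    exists2 z, z \in s :\: T & z |: T \in M.

(** The element that [T] gains from a basis inside [a |: H] must be [a]: any other would complete a
    basis inside [H]. *)
Lemma hyperplane_extend (X : finType) (M : {set {set X}}) (H T : {set X}) a :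
  exchange4 M -> ~~ has_basis4 M H -> has_basis4 M (a |: H) ->
  T \subset H -> #|T| = 3 -> a |: T \in M.
Proof.
move=> exM noH /exists_inP[s sM /andP[saH /eqP s4]] TH T3.
have [z] := exM _ _ T3 sM s4; rewrite inE => /andP[zT zs] zM.
have := subsetP saH _ zs; rewrite in_setU1 => /orP[/eqP <- //|zH].
case/negP: noH; apply/exists_inP; exists (z |: T) => //.
by rewrite subUset sub1set zH TH cardsU1 zT T3.
Qed.

(* [H] is a hyperplane missing exactly [a] and [b] in the set considered. *)
Lemma dependent4_pair (X : finType) (M : {set {set X}}) (H : {set X}) a b :
  exchange4 M -> a != b -> a \notin H -> b \notin H ->
  ~~ has_basis4 M H -> has_basis4 M (a |: H) -> has_basis4 M (b |: H) ->
  #|dependent4 M (a |: (b |: H))| <= 'C(#|H|, 4) + #|H| %/ 2.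
Proof.
move=> exM ab aH bH noH hasa hasb.
set D := dependent4 M _.
pose Dab := [set d in D | (a \in d) && (b \in d)].
pose Q := [set d : {set X} | d \subset H & #|d| == 4].
have sDQ : D \subset Q :|: Dab.
  apply/subsetP => d dD; rewrite in_setU [d \in Dab]inE dD /=.
  move: dD; rewrite !inE => /and3P[dY /eqP d4 dM].
  (* If [d] contains [c] but not [c'], then [d :\ c] is a 3-subset of [H], so [hyperplane_extend]
     makes [d] independent. *)
  have extend c c' : c' \notin d -> has_basis4 M (c |: H) ->
      d \subset c |: (c' |: H) -> c \notin d.
    move=> c'd hasc dcc'; apply: contra dM => cd.
    rewrite -(setD1K cd); apply: hyperplane_extend exM noH hasc _ _.
      apply/subsetP => x; rewrite !inE => /andP[xc xd].
      have := subsetP dcc' _ xd; rewrite !inE (negPf xc) /=.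
      by case/orP => // /eqP xc'; rewrite xc' (negPf c'd) in xd.
    by move: d4; rewrite (cardsD1 c) cd => -[].
  have dY' : d \subset b |: (a |: H) by rewrite setUCA.
  have [ad|ad] := boolP (a \in d); have [bd|bd] := boolP (b \in d) => //=.
  - by rewrite orbT.
  - by have := extend a b bd hasa dY; rewrite ad.
  - by have := extend b a ad hasb dY'; rewrite bd.
  rewrite d4 eqxx orbF andbT; apply/subsetP => x xd.
  have := subsetP dY _ xd; rewrite !inE.
  by case/or3P => // /eqP xx; rewrite xx ?(negPf ad) ?(negPf bd) in xd.
pose P := [set d :\: [set a; b] | d in Dab].
have DabE d : d \in Dab -> d = [set a; b] :|: (d :\: [set a; b]).
  rewrite inE => /and3P[_ ad bd]; apply/setP => x; rewrite !inE.
  by have [->|_] := eqVneq x a => //=; have [->|_] := eqVneq x b.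
have cardP : #|P| = #|Dab|.
  apply: card_in_imset => d d' dD d'D e.
  by rewrite (DabE _ dD) (DabE _ d'D) e.
have PE (p : {set X}) : p \in P ->
    [/\ p \subset H, #|p| = 2 & [set a; b] :|: p \notin M].
  case/imsetP => d dD ->; rewrite -(DabE _ dD); move: dD.
  rewrite 2!inE => /and3P[/and3P[dY /eqP d4 dM] ad bd]; split => //.
    apply/subsetP => x; rewrite !inE negb_or => /andP[/andP[xa xb] xd].
    by have := subsetP dY _ xd; rewrite !inE (negPf xa) (negPf xb).
  rewrite cardsDS ?d4 ?cards2 ?ab //.
  by apply/subsetP => x; rewrite !inE => /orP[] /eqP->.
(* If [p] and [q] share only [x], then [a |: (p :|: q)] is a basis; exchanging from it into
   [{a, b, x}] adds the other point of [p] or of [q], making [{a, b}] joined with that pair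
   independent. *)
have trivP : trivIset P.
  apply/trivIsetP => p q pP qP pq; apply/pred0P => x /=.
  apply/negbTE/negP => /andP[xp xq].
  have [pH p2 pM] := PE p pP; have [qH q2 qM] := PE q qP.
  have xH := subsetP pH _ xp.
  have pq3 : #|p :|: q| = 3.
    have le1 : 1 <= #|p :&: q| by apply/card_gt0P; exists x; rewrite inE xp.
    have lt2 : #|p :&: q| < 2.
      rewrite ltnNge; apply: contra pq => le2.
      have pIq : p :&: q = p by apply/eqP; rewrite eqEcard subsetIl p2.
      have pIq' : p :&: q = q by apply/eqP; rewrite eqEcard subsetIr q2.
      by rewrite -[p in p == _]pIq pIq'.
    have pq1 : #|p :&: q| = 1 by apply/eqP; rewrite eqn_leq -ltnS lt2.
    by rewrite cardsU p2 q2 pq1.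
  have pqH : p :|: q \subset H by rewrite subUset pH.
  have sM := hyperplane_extend exM noH hasa pqH pq3.
  have apq : a \notin p :|: q by apply: contra aH => /(subsetP pqH).
  have xa : x != a by apply: contraNneq aH => <-.
  have xb : x != b by apply: contraNneq bH => <-.
  have T3 : #|[set a; b] :|: [set x]| = 3.
    by rewrite setUC cardsU1 cards2 ab !inE negb_or xa xb.
  have [|z] := exM _ _ T3 sM; first by rewrite cardsU1 apq pq3.
  rewrite !inE !negb_or => /andP[/andP[/andP[za zb] zx]].
  rewrite (negPf za) /= => zpq zM.
  have pair (r : {set X}) : r \subset H -> #|r| = 2 -> x \in r -> z \in r ->
      [set a; b] :|: r \in M.
    move=> rH r2 xr zr; suff -> : [set a; b] :|: r =
       z |: ([set a; b] :|: [set x]) by [].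
    suff -> : r = [set z; x].
      by apply/setP => y; rewrite !inE; do 4!case: (y == _).
    apply/eqP; rewrite eq_sym eqEcard cards2 zx r2 andbT.
    by apply/subsetP => y; rewrite !inE => /orP[] /eqP->.
  by case/orP: zpq => [zp|zq]; [case/negP: pM|case/negP: qM]; apply: pair.
have leDab : 2 * #|Dab| <= #|H|.
  by rewrite -cardP; apply: card_trivIset_const trivP _ => p /PE[].
have QE : #|Q| = 'C(#|H|, 4) by rewrite -cards_draws.
apply: leq_trans (subset_leq_card sDQ) _.
apply: leq_trans (leq_card_setU Q Dab) _.
by rewrite QE leq_add2l leq_divRL // mulnC.
Qed.

Lemma has_basis4_small (X : finType) (M : {set {set X}}) (Y : {set X}) :
  has_basis4 M Y -> 4 <= #|Y|.
Proof.
by case/exists_inP=> s _ /andP[/subset_leq_card + /eqP s4]; rewrite s4.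
Qed.

Lemma dependent4_le (X : finType) (M : {set {set X}}) (Y : {set X}) k :
  exchange4 M -> #|Y| = k + 5 ->
  (forall e, e \in Y -> has_basis4 M (Y :\ e)) ->
  #|dependent4 M Y| <= dependent4_bound k.
Proof.
move=> exM; elim: k Y => [|k IHk] Y cY hasY.
  (* With five elements, every 4-subset is some [Y :\ e] and so equals the basis inside it. *)
  suff -> : dependent4 M Y = set0 by rewrite cards0.
  apply/setP => d; rewrite !inE; apply/negbTE/negP => /and3P[dY /eqP d4 dM].
  have /card_gt0P[e] : 0 < #|Y :\: d| by rewrite cardsDS // cY d4.
  rewrite inE => /andP[ed eY].
  have /exists_inP[s sM /andP[sY /eqP s4]] := hasY e eY.
  case/negP: dM; suff -> : d = s by [].
  have cYe : #|Y :\ e| = 4 by move: cY; rewrite (cardsD1 e) eY; lia.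
  have -> : s = Y :\ e by apply/eqP; rewrite eqEcard sY s4 cYe.
  by apply/eqP; rewrite eqEcard subsetD1 dY ed d4 cYe.
have [/existsP[a /andP[aY]] | noab] := boolP
    [exists a, (a \in Y) && [exists b in Y :\ a, ~~ has_basis4 M (Y :\ a :\ b)]].
  case/exists_inP => b bYa noH; have bY := subsetP (subD1set _ _) _ bYa.
  have ab : a != b by move: bYa; rewrite !inE eq_sym => /andP[].
  pose H := Y :\ a :\ b.
  have bH : b |: H = Y :\ a by rewrite setD1K.
  have aH : a |: H = Y :\ b.
    by apply/setP => x; rewrite !inE; have [->|_] := eqVneq x a; rewrite ?ab.
  have YE : Y = a |: (b |: H) by rewrite bH setD1K.
  have cH : #|H| = k + 4.
    by move: cY; rewrite (cardsD1 a) aY (cardsD1 b) bYa -/H; lia.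
  have := @dependent4_pair _ M H a b exM ab; rewrite -YE aH bH.
  rewrite !inE !eqxx ?andbF /= => /(_ isT isT noH (hasY b bY) (hasY a aY)).
  rewrite cH /dependent4_bound => /leq_trans; apply.
  have -> : k + 4 = k.+4 by lia.
  (* The terms ['C(k.+4, 4)] cancel; after doubling it remains that
     [k + 4 <= 2 + (k + 2)(k + 1)]. *)
  rewrite -addnA leq_add2l -(leq_pmul2l (isT : 0 < 2)) mulnDr mul_bin2.
  by apply: leq_trans (_ : k.+4 <= _); [rewrite mulnC leq_divM | nia].
have bound e : e \in Y -> #|dependent4 M (Y :\ e)| <= dependent4_bound k.
  move=> eY; apply: IHk => [|b bYe].
    by move: cY; rewrite (cardsD1 e) eY; lia.
  move/existsPn: noab => /(_ e); rewrite eY /= => /exists_inPn /(_ b bYe).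
  by rewrite negbK.
have : \sum_(e in Y) #|dependent4 M (Y :\ e)| <= #|Y| * dependent4_bound k.
  by rewrite -sum_nat_const; apply: leq_sum.
rewrite dependent4_deletion cY.
have -> : k.+1 + 5 = k + 6 by lia.
have -> : k + 6 - 4 = k + 2 by lia.
move=> /leq_trans /(_ (dependent4_bound_step k)).
by rewrite leq_pmul2l // addn2.
Qed.

(** * Face numbers and the top h-number *)

Definition face_number (X : finType) (M : {set {set X}}) (k : nat) : nat :=
  #|[set s in M | #|s| == k]|.

Lemma mrank_basis (X : finType) (M : {set {set X}}) :
  matroid M -> exists2 s, s \in M & #|s| = mrank M.
Proof.
case=> _ /set0Pn M0 _ _.
have [|s sM e] := @eq_bigmax_cond _ (mem M) (fun s : {set X} => #|s|).
  exact/card_gt0P.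
by exists s => //; apply: esym.
Qed.

Lemma paving_exchange4 (X : finType) (M : {set {set X}}) :
  paving M -> mrank M = 4 -> exchange4 M.
Proof.
move=> [[_ _ _ exM] pavM] r4 T s T3 sM s4.
by apply: exM => //; [apply: pavM; rewrite T3 r4 | rewrite T3 s4].
Qed.

Lemma face_number_basis4 (X : finType) (M : {set {set X}}) :
  face_number M 4 + #|dependent4 M setT| = 'C(#|X|, 4).
Proof.
rewrite -card_draws -(cardsID M [set A : {set X} | #|A| == 4]) /face_number.
congr (_ + _); apply: eq_card => s; rewrite !inE; first exact: andbC.
by rewrite subsetT /= andbC.
Qed.

Lemma face_number_small (X : finType) (M : {set {set X}}) k :
  paving M -> mrank M = 4 -> 4 <= #|X| -> k < 4 ->
  face_number M k = 'C(#|X|, k).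
Proof.
move=> [[_ _ subM _] pavM] r4 X4 k4; rewrite -card_draws.
have inM j (s : {set X}) : #|s| + j = 3 -> s \in M.
  elim: j s => [|j IHj] s sj; first by apply: pavM; rewrite r4; lia.
  have /card_gt0P[x] : 0 < #|~: s| by have := cardsC s; lia.
  rewrite inE => xs; apply: (subM _ (x |: s)); last exact: subsetUr.
  by apply: IHj; rewrite cardsU1 xs; lia.
apply: eq_card => s; rewrite !inE andbC; case: eqP => //= sk.
by apply: (inM (3 - k)); lia.
Qed.

(** [e] is a coloop, and removing it is a bijection from the bases to the 3-subsets of its
    complement. *)
Lemma face_number_coloop (X : finType) (M : {set {set X}}) e :
  paving M -> mrank M = 4 -> ~~ has_basis4 M (setT :\ e) ->
  face_number M 4 = 'C(#|X|.-1, 3).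
Proof.
move=> pavM r4 noH; have exM := paving_exchange4 pavM r4.
have [s0 s0M] := mrank_basis (proj1 pavM); rewrite r4 => s04.
have hasX : has_basis4 M (e |: (setT :\ e)).
  by apply/exists_inP; exists s0; rewrite // setD1K ?inE // subsetT s04.
have -> : #|X|.-1 = #|[set: X] :\ e|.
  by rewrite -cardsT (cardsD1 e) inE.
rewrite -cards_draws.
rewrite -(card_in_imset (f := fun T : {set X} => e |: T)).
  apply: eq_card => s; rewrite !inE; apply/idP/imsetP.
    move=> /andP[sM /eqP s4]; have es : e \in s.
      apply: contraR noH => es; apply/exists_inP; exists s => //.
      by rewrite subsetD1 subsetT es s4.
    exists (s :\ e); last by rewrite setD1K.
    by rewrite inE setSD ?subsetT //=; move: s4; rewrite (cardsD1 e) es => -[] /eqP.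
  case=> T; rewrite inE => /andP[TH /eqP T3] ->.
  rewrite (hyperplane_extend exM noH hasX TH T3) /= cardsU1 T3.
  by move: TH; rewrite subsetD1 => /andP[_ ->].
move=> T T'; rewrite !inE !subsetD1 => /andP[/andP[_ eT] _] /andP[/andP[_ eT'] _].
by move=> TT'; rewrite -(setU1K eT) TT' setU1K.
Qed.

(** Since ['C(n.+3, 3) = 1 + n + h2 + h3], this [h4] is the top h-number. The inequality is
    [H (-1) >= 0] free of subtraction, and is [dependent4_le] rewritten by Pascal's rule. *)
Lemma paving4_top_h (X : finType) (M : {set {set X}}) n :
  paving M -> mrank M = 4 -> #|X| = n + 4 ->
  exists2 h4, face_number M 4 = 'C(n.+3, 3) + h4 &
    h4 = 0 \/ 0 < n /\ 'C(n.+2, 3) + n <= h4 + 'C(n.+1, 2) + 1.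
Proof.
move=> pavM r4 Xn.
have [/existsP[e noH]|] := boolP [exists e, ~~ has_basis4 M (setT :\ e)].
  exists 0; last by left.
  by rewrite (face_number_coloop pavM r4 noH) Xn addn0 !addnS addn0.
move=> /existsPn hasX; have {}hasX e : has_basis4 M (setT :\ e).
  by have := hasX e; rewrite negbK.
have [s0 s0M] := mrank_basis (proj1 pavM); rewrite r4 => s04.
have /card_gt0P[e _] : 0 < #|s0| by rewrite s04.
have := has_basis4_small (hasX e); have := cardsD1 e [set: X].
rewrite inE cardsT Xn => /= XE.
case: n Xn XE => [|k] Xn XE; first by lia.
move=> _; have := @dependent4_le X M setT k (paving_exchange4 pavM r4).
rewrite cardsT Xn => /(_ (addSnnS _ _) (fun e _ => hasX e)).
have := face_number_basis4 M; rewrite Xn /dependent4_bound.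
have -> : k.+1 + 4 = k.+4.+1 by lia.
move: (face_number M 4) #|_| => F D.
rewrite !binS !bin1 !bin0 => FD D_le.
(* The subtraction is not truncated: [D_le] forces [F] to be at least ['C(k.+4, 3)]. *)
exists (F - ('C(k.+4, 3))); last right; rewrite !binS !bin1 !bin0; lia.
Qed.

(** * Schur-Cohn estimates outside the unit disk *)

Local Open Scope ring_scope.
Local Open Scope complex_scope.

(** The squared modulus, valued in [R], keeps all estimates polynomial in real coordinates. *)
Definition normsq (R : rcfType) (u : R[i]) : R :=
  complex.Re u ^+ 2 + complex.Im u ^+ 2.

Lemma normsqM (R : rcfType) (u v : R[i]) :
  normsq (u * v) = normsq u * normsq v.
Proof. by case: u v => [a b] [c d]; rewrite /normsq /=; ring. Qed.

Lemma normsq0 (R : rcfType) : normsq (0 : R[i]) = 0.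
Proof. by rewrite /normsq /= expr0n addr0. Qed.

Lemma normsq_ge0 (R : rcfType) (u : R[i]) : 0 <= normsq u.
Proof. by rewrite addr_ge0 ?sqr_ge0. Qed.

Lemma normsq_le1 (R : rcfType) (z : R[i]) : (`|z| <= 1) = (normsq z <= 1).
Proof.
case: z => a b; rewrite normc_def /= lecR -[X in _ <= X]sqrtr1 ler_sqrt //.
Qed.

(* The Schur-Cohn recursion: for [u = p z] and [v = p^* z], where [p^*] is the
   reciprocal polynomial of [p] and [a], [b] are its extreme coefficients, [u1]
   and [v1] are the same data for a polynomial of smaller degree. *)
Lemma schur_step (R : rcfType) (a b : R) (z u v u1 v1 : R[i]) :
  b ^+ 2 < a ^+ 2 -> 1 < normsq z ->
  z * u1 = a%:C * u - b%:C * v -> v1 = a%:C * v - b%:C * u ->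
  normsq v1 <= normsq u1 -> 0 < normsq u1 -> normsq v < normsq u.
Proof.
move=> ab z1 hu hv le1 u0.
have e : (a ^+ 2 - b ^+ 2) * (normsq u - normsq v) =
    normsq z * normsq u1 - normsq v1.
  rewrite -normsqM hu hv; case: (u) (v) => [u2 u3] [v2 v3].
  by rewrite /normsq /=; ring.
have : 0 < (a ^+ 2 - b ^+ 2) * (normsq u - normsq v).
  by rewrite e; nra.
by rewrite pmulr_rgt0 ?subr_gt0.
Qed.

(** The difference of the two sides is [(a^2 - b^2)(|z|^2 - 1)]. Equality [|b| = a] is allowed, so
    positivity is recorded separately to make the next step strict. *)
Lemma schur_linear (R : rcfType) (a b : R) (z : R[i]) :
  `|b| <= a -> 0 < a -> 1 < normsq z ->
  normsq (b%:C * z + a%:C) <= normsq (a%:C * z + b%:C) /\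
  0 < normsq (a%:C * z + b%:C).
Proof.
move=> ba a0; case: z => x y; rewrite /normsq /= => z1.
move: ba; rewrite ler_norml => /andP[b1 b2].
have le_ba : b ^+ 2 <= a ^+ 2 by nra.
split.
  rewrite -subr_ge0; set w := (X in 0 <= X).
  have -> : w = (a ^+ 2 - b ^+ 2) * (x ^+ 2 + y ^+ 2 - 1) by rewrite /w; ring.
  by apply: mulr_ge0; rewrite subr_ge0 // ltW.
(* [a z + b = 0] would give [a^2 |z|^2 = b^2 <= a^2]. *)
rewrite lt_def addr_ge0 ?sqr_ge0 // andbT paddr_eq0 ?sqr_ge0 // !sqrf_eq0.
apply/negP => /andP[/eqP e1 /eqP e2].
have ex : a * x = - b by lra.
have ey : a * y = 0 by lra.
have : a ^+ 2 * (x ^+ 2 + y ^+ 2) = b ^+ 2.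
  by rewrite mulrDr -!exprMn ex ey; ring.
have : 0 < a ^+ 2 * (x ^+ 2 + y ^+ 2 - 1) by rewrite mulr_gt0 ?exprn_gt0 ?subr_gt0.
lra.
Qed.

(** The condition [|b| <= a + c] says that the quadratic is nonnegative at 1 and -1; the reduced
    polynomial is [(a^2 - c^2) z + b (a - c)]. *)
Lemma schur_quadratic (R : rcfType) (a b c : R) (z : R[i]) :
  `|c| < a -> `|b| <= a + c -> 1 < normsq z ->
  normsq (c%:C * z ^+ 2 + b%:C * z + a%:C) <
  normsq (a%:C * z ^+ 2 + b%:C * z + c%:C).
Proof.
move=> ca bac z1; have [ca1 ca2] : - a < c /\ c < a.
  by move: ca; rewrite ltr_norml => /andP[].
have [] := @schur_linear R (a ^+ 2 - c ^+ 2) (b * (a - c)) z _ _ z1.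
- have ac0 : 0 <= a - c by lra.
  by rewrite normrM (ger0_norm ac0); nra.
- nra.
apply: (@schur_step R a c z) => //; first by nra.
  by rewrite !(rmorphB, rmorphM, rmorphXn) /=; ring.
by rewrite !(rmorphB, rmorphM, rmorphXn) /=; ring.
Qed.

Lemma schur_cubic (R : rcfType) (a b c d : R) (z : R[i]) :
  0 <= d -> d <= b -> d < a -> 0 <= c -> c < a -> b + d <= a + c ->
  1 < normsq z ->
  normsq (d%:C * z ^+ 3 + c%:C * z ^+ 2 + b%:C * z + a%:C) <
  normsq (a%:C * z ^+ 3 + b%:C * z ^+ 2 + c%:C * z + d%:C).
Proof.
move=> d0 db da c0 ca bd z1.
have q1 : `|a * c - b * d| < a ^+ 2 - d ^+ 2.
  rewrite ltr_norml; apply/andP; split; last by nra.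
  have : 0 < (a + c) * (a - d) by nra.
  nra.
(* The reduced quadratic is nonnegative at 1 and -1, where its values factor through those of the
   cubic at the same points. *)
have q2 : `|a * b - c * d| <= a ^+ 2 - d ^+ 2 + (a * c - b * d).
  rewrite ler_norml; apply/andP; split.
    have -> : a ^+ 2 - d ^+ 2 + (a * c - b * d) =
       (a - d) * (a + b + c + d) - (a * b - c * d) by ring.
    have : 0 <= (a - d) * (a + b + c + d) by nra.
    lra.
  rewrite -subr_ge0.
  have -> : a ^+ 2 - d ^+ 2 + (a * c - b * d) - (a * b - c * d) =
       (a + d) * (a + c - b - d) by ring.
  by nra.
have lt2 := schur_quadratic q1 q2 z1.
apply: (@schur_step R a d z) (ltW lt2) _ => //; first by nra.
- by rewrite !(rmorphB, rmorphM, rmorphXn) /=; ring.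
- by rewrite !(rmorphB, rmorphM, rmorphXn) /=; ring.
exact: le_lt_trans (normsq_ge0 _) lt2.
Qed.

Lemma schur_quartic (R : rcfType) (n h2 h3 h4 : R) (z : R[i]) :
  1 < h4 -> h2 < h4 + 1 -> 0 <= h2 -> n <= h4 -> 0 < n -> n <= h3 ->
  h3 <= h4 * n -> h3 - h2 + n - 1 <= h4 -> 1 < normsq z ->
  h4%:C * z ^+ 4 + h3%:C * z ^+ 3 + h2%:C * z ^+ 2 + n%:C * z + 1 != 0.
Proof.
move=> h4_1 h24 h2_0 nh4 n0 nh3 h34 le4 z1; apply/eqP => e.
have [] : 0 <= h4 * n - h3 /\ h4 * n - h3 <= h4 * h3 - n by split; nra.
have : h4 * n - h3 < h4 ^+ 2 - 1 by nra.
have : 0 <= (h4 - 1) * h2 by nra.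
have : (h4 - 1) * h2 < h4 ^+ 2 - 1 by nra.
(* The sign condition at -1 for the reduced cubic is [(h4 - 1) * H (-1) >= 0]. *)
have : h4 * h3 - n + (h4 * n - h3) <= h4 ^+ 2 - 1 + (h4 - 1) * h2.
  rewrite -subr_ge0; set w := (X in 0 <= X).
  have -> : w = (h4 - 1) * (h4 - (h3 - h2 + n - 1)) by rewrite /w; ring.
  by apply: mulr_ge0; lra.
move=> k1 k2 k3 k4 k5 k6; have lt3 := schur_cubic k5 k6 k4 k3 k2 k1 z1.
suff : normsq (1 * z ^+ 4 + n%:C * z ^+ 3 + h2%:C * z ^+ 2 + h3%:C * z + h4%:C)
    < normsq (h4%:C * z ^+ 4 + h3%:C * z ^+ 3 + h2%:C * z ^+ 2 + n%:C * z + 1).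
  by rewrite e normsq0 ltNge normsq_ge0.
apply: (@schur_step R h4 1 z) (ltW lt3) _ => //.
- by rewrite expr1n; nra.
- by rewrite !(rmorphB, rmorphM, rmorphXn, rmorph1) /=; ring.
- by rewrite !(rmorphB, rmorphM, rmorphXn, rmorph1) /=; ring.
exact: le_lt_trans (normsq_ge0 _) lt3.
Qed.

(** * Roots of the h-polynomial *)

Lemma h_polynomial_root (R : rcfType) (n h4 : nat) (z : R[i]) :
  h4 = 0%N \/ (0 < n /\ 'C(n.+2, 3) + n <= h4 + 'C(n.+1, 2) + 1)%N ->
  (n = 1 -> h4 <= 1)%N ->
  h4%:R * z ^+ 4 + ('C(n.+2, 3))%:R * z ^+ 3 + ('C(n.+1, 2))%:R * z ^+ 2
    + n%:R * z + 1 = 0 -> normsq z <= 1.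
Proof.
move=> h4P n1 e; rewrite leNgt; apply/negP => z1.
have unity k : (0 < k)%N -> z ^+ k != 1.
  move=> k0; apply/eqP => zk; have : normsq (z ^+ k) = 1.
    by rewrite zk /normsq /= expr1n expr0n addr0.
  have -> : normsq (z ^+ k) = normsq z ^+ k.
    elim: (k) => [|j IHj]; last by rewrite !exprS normsqM IHj.
    by rewrite !expr0 /normsq /= expr1n expr0n addr0.
  by move=> e1; have := exprn_egt1 k z1; rewrite e1 ltxx => /esym; lia.
(* For [n = 0], [H] is 1; for [n = 1] it is a geometric sum of 4 or 5 terms, whose roots are roots
   of unity. Otherwise [n = k + 2]. *)
case: n h4P n1 e => [|[|k]] h4P n1 e.
- case: h4P => [h40|[]//]; move: e; rewrite h40 !bin_small //.
  by rewrite !mul0r !add0r => /eqP; rewrite oner_eq0.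
- have := n1 erefl; rewrite !binn in e; case: (h4) e => [|[|//]] e _.
    have /eqP[] := unity 4 isT; apply/eqP; rewrite -subr_eq0.
    have -> : z ^+ 4 - 1 = (z - 1) * (z ^+ 3 + z ^+ 2 + z + 1) by ring.
    move: e; rewrite !mul1r mul0r add0r => ->; by rewrite mulr0.
  have /eqP[] := unity 5 isT; apply/eqP; rewrite -subr_eq0.
  have -> : z ^+ 5 - 1 = (z - 1) * (z ^+ 4 + z ^+ 3 + z ^+ 2 + z + 1) by ring.
  by move: e; rewrite !mul1r => ->; rewrite mulr0.
have castE j : (j%:R : R[i]) = (j%:R)%:C by rewrite rmorph_nat.
pose K : R := k%:R; have K0 : 0 <= K by [].
have nE : k.+2%:R = K + 2 :> R by rewrite -addn2 natrD.
have h2E : 2 * ('C(k.+3, 2))%:R = (K + 3) * (K + 2) :> R.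
  rewrite -(natrM _ 2) mul_bin2 natrM -!natr1 -/K; ring.
have h3E : 6 * ('C(k.+4, 3))%:R = (K + 4) * (K + 3) * (K + 2) :> R.
  rewrite -(natrM _ 6) mul_bin3 !natrM -!natr1 -/K; ring.
have h4le : h4 = 0%N \/
    ('C(k.+4, 3))%:R + (K + 2) <= h4%:R + ('C(k.+3, 2))%:R + 1 :> R.
  case: h4P => [|[_]]; [by left | rewrite addn1 => le4; right].
  by rewrite -nE -!natrD natr1 ler_nat.
have h22 : k = 0%N -> ('C(k.+3, 2) = 3)%N /\ ('C(k.+4, 3) = 4)%N by move->.
move: e h2E h3E h4le h22; rewrite !castE nE.
move: 'C(_, _) 'C(_, _) => b2 b3 e h2E h3E h4le h22.
have K2 : 0 <= K * K by nra.
have K3 : 0 <= K * K * K by nra.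
(* For [h4 = 0], [H] is a cubic whose coefficients grow towards the leading one. *)
case: h4le => [h40|h4le].
  have : normsq ((1 : R)%:C * z ^+ 3 + (K + 2)%:C * z ^+ 2 + b2%:R%:C * z
      + b3%:R%:C) < normsq (b3%:R%:C * z ^+ 3 + b2%:R%:C * z ^+ 2 +
      (K + 2)%:C * z + (1 : R)%:C) by apply: schur_cubic => //; lra.
  by move: e; rewrite h40 mul0r add0r => ->; rewrite normsq0 ltNge normsq_ge0.
(* At [n = 2], [h4 = 2] the strict bound [h2 < h4 + 1] of [schur_quartic] becomes an equality; there
   [H] factors explicitly. *)
have [[k0 h42]|k_h4] : (k = 0 /\ h4 = 2)%N \/ (k = 0 /\ 2 < h4 \/ 0 < k)%N.
  case: (posnP k) => [k0|]; last by right; right.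
  have [b2E b3E] := h22 k0; move: h4le; rewrite b2E b3E /K k0 => le4.
  have : (2 <= h4)%N by rewrite -(ler_nat R); lra.
  by rewrite leq_eqVlt => /orP[/eqP <-|]; [left | right; left].
- have [b2E b3E] := h22 k0; move: e; rewrite b2E b3E h42 /K k0 -!castE.
  have -> : ((0 + 2 : R)%:C = 2 :> R[i]) by rewrite add0r castE.
  have -> : 2 * z ^+ 4 + 4 * z ^+ 3 + 3 * z ^+ 2 + 2 * z + 1 =
    (z + 1) ^+ 2 * (2 * z ^+ 2 + 1) by ring.
  move/eqP; rewrite mulf_eq0 sqrf_eq0 => /orP[]; rewrite addr_eq0 => /eqP ez.
    by have := unity 2 isT; rewrite ez sqrrN expr1n eqxx.
  have : normsq (2 * z ^+ 2) = 4 * normsq z ^+ 2.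
    by rewrite !normsqM /normsq /=; ring.
  by rewrite ez; rewrite [normsq (-1)]/normsq /=; nra.
suff [c1 c2 c3 c4] : [/\ b2%:R < h4%:R + 1 :> R, K + 2 <= h4%:R,
    b3%:R <= h4%:R * (K + 2) & K + 2 <= b3%:R].
  have : h4%:R%:C * z ^+ 4 + b3%:R%:C * z ^+ 3 + b2%:R%:C * z ^+ 2
      + (K + 2)%:C * z + 1 != 0 by apply: schur_quartic => //; lra.
  by rewrite e eqxx.
case: k_h4 => [[k0 h43]|k0].
  have [b2E b3E] := h22 k0; move: h43; rewrite b2E b3E /K k0.
  by rewrite -(ltr_nat R) => h43; split; lra.
have K1 : 1 <= K by rewrite /K (ler_nat _ 1).
have K4 : 0 <= K * K * K * K by nra.
(* Six times [h3 - h2 + n - 1 <= h4], expanded in [K = n - 2]. *)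
have L : (K * K * K + 6 * (K * K) + 17 * K + 12) <= 6 * h4%:R by nra.
split; nra.
Qed.

(** * From the reliability polynomial to the h-polynomial *)

Lemma Rel_horner (K : comNzRingType) (X : finType) (M : {set {set X}}) (z : K) :
  mrank M = 4%N -> (4 <= #|X|)%N ->
  (Rel K M).[z] = (1 - z) ^+ (#|X| - 4) *
    \sum_(k < 5) (face_number M k)%:R * z ^+ k * (1 - z) ^+ (4 - k).
Proof.
move=> r4 X4; rewrite /Rel horner_sum mulr_sumr.
have s4 s : s \in M -> (#|s| < 5)%N.
  by move=> sM; rewrite ltnS -r4; apply: leq_bigmax_cond.
(* Grouping by cardinality; [s4] ensures that [inord] never takes its default value. *)
rewrite (partition_big (fun s : {set X} => inord #|s| : 'I_5) predT) //=.
apply: eq_bigr => k _.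
rewrite (eq_bigl [in [set s in M | #|s| == k :> nat]]); last first.
  move=> s; rewrite !inE; case sM: (s \in M) => //=.
  by rewrite -val_eqE /= inordK // s4.
rewrite (eq_bigr (fun _ => z ^+ k * (1 - z) ^+ (#|X| - k))).
  rewrite sumr_const -/(face_number M k) -mulr_natl.
  have -> : (#|X| - k = (#|X| - 4) + (4 - k))%N by have := ltn_ord k; lia.
  by rewrite exprD; ring.
move=> s; rewrite inE => /andP[_ /eqP sk].
rewrite hornerM !horner_exp hornerD hornerN hornerX hornerC sk.
by rewrite cardsCs setCK sk.
Qed.

Theorem theorem6 (R : realType) (X : finType) (M : {set {set X}})
    (M_paving : paving M) (M_rank : mrank M = 4%N)
    (z : R[i]) (z_root : root (Rel R[i] M) z) : `|z| <= 1.
Proof.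
rewrite normsq_le1.
have [s sM] := mrank_basis (proj1 M_paving); rewrite M_rank => s4.
have X4 : (4 <= #|X|)%N by rewrite -s4 max_card.
pose n := (#|X| - 4)%N; have Xn : #|X| = (n + 4)%N by rewrite subnK.
have [->|z1] := eqVneq z 1.
  by rewrite /normsq /= expr1n expr0n addr0.
have [h4 FE h4P] := paving4_top_h M_paving M_rank Xn.
apply: (h_polynomial_root h4P).
  (* Five elements have at most 5 four-subsets, and ['C(4, 3) = 4] of them are already accounted
     for. *)
  move=> n1; have := face_number_basis4 M.
  rewrite FE Xn n1 => h; rewrite -[(1 + 4)%N]/5%N in h.
  have : ('C(5, 4) = 5 /\ 'C(4, 3) = 4)%N by [].
  lia.
have f k : (k < 4)%N -> face_number M k = 'C(n + 4, k).
  by move=> k4; rewrite (face_number_small M_paving M_rank X4 k4) Xn.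
move: z_root; rewrite /root Rel_horner // mulf_eq0 expf_eq0 subr_eq0.
rewrite (eq_sym 1) (negPf z1) andbF /= => /eqP.
rewrite !big_ord_recr big_ord0 /= FE !f // => e.
(* Replacing 0 by the face-number sum leaves the polynomial identity between the f-form and the
   h-form of [H]. *)
rewrite -[RHS]e {e}.
have -> : (n + 4 = n.+4)%N by rewrite addnC.
rewrite !binS !bin1 !bin0.
rewrite !natrD -!natr1; ring.
Qed.
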